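(* For every finite simple graph $G$ with nonempty vertex set and no isolated vertices, $$\tau^2\ \ge\ 2\tilde h-1.$$ Moreover, the inequality is sharp, i.e., there exist such graphs for which equality holds.
   Context: For a simple graph $G=(V,E)$ on $n$ vertices without isolated vertices, with adjacency matrix $A$ and diagonal degree matrix $D$, the normalized Laplacian is $L:=\mathrm{Id}-D^{-1}A$, with real eigenvalues (counted with multiplicity) $0=\lambda_1\le\lambda_2\le\dots\le\lambda_n\le2$. Set $\tau:=\max_{i\ne1}|1-\lambda_i|$, the maximum being over indices $i\in\{2,\dots,n\}$. For $w\in V$ and $S\subseteq V$, $e(w,S)$ is the number of neighbors of $w$ that lie in $S$, and $\mathrm{vol}\,S:=\sum_{v\in S}\deg v$. For nonempty $S\subseteq V$, $$\tilde h(S):=\frac{1}{\mathrm{vol}\,S}\sum_{w\in V}\frac{e(w,S)^2}{\deg w},\qquad \tilde h:=\max_{\emptyset\ne S\subseteq V,\ \mathrm{vol}\,S\le \mathrm{vol}\,V/2}\tilde h(S).$$ *)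

(* Defs.v *)
From mathcomp Require Import all_boot all_order all_algebra.
From mathcomp Require Import polyrcf reals.

Set Implicit Arguments.
Unset Strict Implicit.
Unset Printing Implicit Defensive.

Import Order.TTheory GRing.Theory Num.Theory.
Local Open Scope ring_scope.

Definition simple_graph (T : finType) (e : rel T) : Prop :=
  symmetric e /\ irreflexive e.

Definition deg (T : finType) (e : rel T) (v : T) : nat := #|[set w | e v w]|.

Definition no_isolated_vertex (T : finType) (e : rel T) : Prop :=
  forall v : T, (0 < deg e v)%N.

Definition edges_to (T : finType) (e : rel T) (w : T) (S : {set T}) : nat :=
  #|[set v in S | e w v]|.

Definition vol (T : finType) (e : rel T) (S : {set T}) : nat :=
  (\sum_(v in S) deg e v)%N.

(* The vertices of T are numbered by enum_val : 'I_#|T| -> T. *)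
Definition adjacency_mx (R : realType) (T : finType) (e : rel T) : 'M[R]_#|T| :=
  \matrix_(i, j) (e (enum_val i) (enum_val j))%:R.

Definition degree_mx (R : realType) (T : finType) (e : rel T) : 'M[R]_#|T| :=
  diag_mx (\row_i (deg e (enum_val i))%:R).

Definition normalized_laplacian (R : realType) (T : finType) (e : rel T) :
    'M[R]_#|T| :=
  1%:M - invmx (degree_mx R e) *m adjacency_mx R e.

(* rootsR lists the distinct real roots in increasing order; repeating each one
   gives the nondecreasing list of real eigenvalues with multiplicity. *)
Definition real_spectrum (R : realType) (n : nat) (M : 'M[R]_n) : seq R :=
  flatten [seq nseq (mup x (char_poly M)) x | x <- rootsR (char_poly M)].

(* Indices start at 0, so the index i <> 1 of the mathematics is 1 <= i < n
   here.  All terms are nonnegative and, in the absence of isolated vertices,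
   n >= 2, so the default value 0 does not affect the maximum. *)
Definition tau (R : realType) (T : finType) (e : rel T) : R :=
  \big[Num.max/0]_(1 <= i < #|T|)
    `|1 - (real_spectrum (normalized_laplacian R e))`_i|.

Definition htilde_set (R : realType) (T : finType) (e : rel T) (S : {set T}) :
    R :=
  (vol e S)%:R^-1 * \sum_(w : T) (edges_to e w S)%:R ^+ 2 / (deg e w)%:R.

(* All terms are nonnegative, and in a nonempty graph without isolated vertices
   a vertex of minimum degree is an admissible S, so the default value 0 does
   not affect the maximum. *)
Definition htilde (R : realType) (T : finType) (e : rel T) : R :=
  \big[Num.max/0]_(S : {set T} | (S != set0) &&
      ((vol e S)%:R <= (vol e [set: T])%:R / 2 :> R))
    htilde_set R e S.

(* Main.v *)
Require Import Defs.
From mathcomp Require Import all_boot all_order all_algebra.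
From mathcomp Require Import reals.
From mathcomp Require Import polyrcf complex ring lra.
Import Order.TTheory GRing.Theory Num.Theory.
Local Open Scope ring_scope.

(** Write [N] for the symmetric matrix [D^(-1/2) A D^(-1/2)], which is
    [Id - L] up to conjugation by [D^(1/2)], so that its eigenvalues are the
    numbers [1 - lambda_i].  The vector [u := D^(1/2) 1] satisfies [u N = u],
    and for [phi := D^(1/2) 1_S] one has [phi . phi = phi . u = vol S],
    [u . u = vol V] and [|phi N|^2 = \sum_w e(w,S)^2 / deg w], which is
    [vol S] times [h(S)].

    The bound [h(S) <= 1] holds for every [S], because [e(w,S) <= deg w] and
    the [e(w,S)] add up to [vol S].  This settles the case [tau >= 1].  If
    [tau < 1], then the eigenvalue 1 of [N] is simple: it occurs only once
    among the [1 - lambda_i], since all of them but one are at most [tau] in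
    absolute value.  Hence in an orthonormal eigenbasis [u] has one single
    nonzero coordinate, and [N] shrinks all the other coordinates of [phi] by
    a factor at most [tau].  This gives
    [(u . u) |phi N|^2 <=
       tau^2 (u . u) |phi|^2 + (1 - tau^2) (u . phi)^2],
    that is, [h(S) <= tau^2 + (1 - tau^2) vol S / vol V], and the assumption
    [vol S <= vol V / 2] concludes.  The pieces are [symmetric_spectral],
    [norm_sq_le_simple_fixed], [le_of_tail_le] and [htilde_set_le_tau].

    Equality holds for the graph with two vertices and one edge: a singleton
    [S] there has [h(S) = 1], while [tau <= 1] holds in any graph
    ([tau_le1]). *)

Set Implicit Arguments.
Unset Strict Implicit.

(** * Characteristic polynomials and the list of real eigenvalues *)

Lemma char_poly_conj (F : fieldType) (n : nat) (P M : 'M[F]_n) :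
  P \in unitmx -> char_poly (invmx P *m M *m P) = char_poly M.
Proof.
move=> P_unit; rewrite /char_poly /char_poly_mx !map_mxM /=.
have VP : map_mx polyC (invmx P) *m map_mx polyC P = 1%:M :> 'M[{poly F}]_n.
  by rewrite -map_mxM mulVmx ?map_mx1.
(* Write 'X%:M as P^-1 ('X%:M) P. *)
rewrite -[X in X - _]mul1mx -VP -[X in X - _]mulmxA scalar_mxC mulmxA.
by rewrite -mulmxBl -mulmxBr !det_mulmx mulrAC -det_mulmx VP det1 mul1r.
Qed.

Lemma char_poly_diag (F : fieldType) (n : nat) (d : 'rV[F]_n) :
  char_poly (diag_mx d) = \prod_(i < n) ('X - (d 0 i)%:P).
Proof.
rewrite char_poly_trig ?diag_mx_is_trig //.
by apply: eq_bigr => i _; rewrite mxE eqxx mulr1n.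
Qed.

Lemma invmx_diag (F : fieldType) (n : nat) (d : 'rV[F]_n) :
  (forall i, d 0 i != 0) -> invmx (diag_mx d) = diag_mx (\row_i (d 0 i)^-1).
Proof.
move=> d0; pose E := diag_mx (\row_i (d 0 i)^-1).
have ED : E *m diag_mx d = 1%:M.
  rewrite mulmx_diag; apply/matrixP => i j; rewrite !mxE.
  by have [->|//] := eqVneq i j; rewrite mulVf.
have [_ D_unit] := mulmx1_unit ED.
by rewrite -[LHS]mul1mx -ED mulmxK.
Qed.

(** This identifies the sorted list, computed from root isolation, with any
    diagonalization: both list each root as often as its multiplicity. *)
Lemma perm_real_spectrum (R : realType) (n : nat) (M : 'M[R]_n) (r : seq R) :
  char_poly M = \prod_(x <- r) ('X - x%:P) -> perm_eq (real_spectrum M) r.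
Proof.
move=> chM; rewrite /real_spectrum chM.
set p := \prod_(x <- r) _.
have p0 : p != 0 by rewrite monic_neq0 ?monic_prod_XsubC.
have mem_roots x : (x \in rootsR p) = (x \in r).
  have := roots_on_rootsR p0 x; rewrite inE /= => <-.
  by rewrite root_prod_XsubC.
have uniq_rt : uniq (rootsR p) by exact: uniq_roots.
apply/allP => x _ /=; apply/eqP; rewrite count_flatten -map_comp.
under eq_map => y do rewrite /= count_nseq mu_prod_XsubC /=.
have [xr|xr] := boolP (x \in r); last first.
  rewrite (count_memPn xr); apply/eqP; rewrite sumnE big_map big_seq.
  rewrite big1 // => y; rewrite mem_roots => yr.
  by rewrite (negPf (_ : y != x)) //; apply: contraNneq xr => <-.
rewrite sumnE big_map (bigD1_seq x) ?mem_roots //= eqxx mul1n big1 ?addn0 //.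
by move=> y /negPf ->.
Qed.

Lemma real_spectrum_eigenvalue (R : realType) (n : nat) (M : 'M[R]_n) (x : R) :
  x \in real_spectrum M -> eigenvalue M x.
Proof.
case/flatten_mapP => y; have M0 := monic_neq0 (char_poly_monic M).
rewrite -(roots_on_rootsR M0) inE /= => rooty.
by rewrite mem_nseq => /andP[_ /eqP->]; rewrite eigenvalue_root_char.
Qed.

(** When [t < 1], an entry 0 violates the bound on the tail of the list, so
    it can only be the head: the bound is then valid for all the indices of
    [l] but the one where [l] vanishes, in whatever order [l] is given. *)
Lemma le_of_tail_le (R : realType) (n : nat) (s : seq R) (l : 'I_n -> R)
    (t : R) (k : 'I_n) :
    perm_eq s [seq l i | i <- enum 'I_n] ->
    (forall i, (1 <= i < n)%N -> `|1 - s`_i| <= t) -> t < 1 -> l k = 0 ->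
  forall i, i != k -> `|1 - l i| <= t.
Proof.
move=> s_perm s_le t1 lk i ik.
have size_s : size s = n by rewrite (perm_size s_perm) size_map size_enum_ord.
have mem_0s : 0 \in s.
  by rewrite (perm_mem s_perm) -lk map_f // mem_enum.
case: s => [|x s] in s_perm s_le size_s mem_0s *; first by [].
have s_tail y : y \in s -> `|1 - y| <= t.
  move=> /(nthP 0)[j j_lt <-]; apply: (s_le j.+1).
  by rewrite /= -size_s.
have x0 : x = 0.
  move: mem_0s; rewrite inE => /orP[/eqP //|/s_tail].
  by rewrite subr0 normr1 leNgt t1.
have k_enum : k \in enum 'I_n by rewrite mem_enum.
have := perm_trans s_perm (perm_map l (perm_to_rem k_enum)).
rewrite /= lk x0 perm_cons => /perm_mem s_rem.
apply: s_tail; rewrite s_rem map_f //.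
by rewrite mem_rem_uniq ?enum_uniq // inE ik mem_enum.
Qed.

(** * Real symmetric matrices with a simple eigenvalue 1 *)

Local Notation "M '%:CM'" := (map_mx (real_complex _) M)
  (at level 2, left associativity, format "M %:CM").
Local Notation "M '^*t'" := (map_mx Num.conj (trmx M)) (at level 8).

Lemma conj_real_complex (R : rcfType) (x : R) : (x%:C%C)^* = x%:C%C.
Proof. by apply/CrealP; apply/complex_realP; exists x. Qed.

Lemma conj_mx_real_complex (R : rcfType) (m n : nat) (M : 'M[R]_(m, n)) :
  (M%:CM)^*t = M^T%:CM.
Proof. by apply/matrixP => i j; rewrite !mxE conj_real_complex. Qed.

(** The eigenvalues are real, but the eigenbasis is left complex: only the
    squared absolute values of coordinates are used below, and a unitary
    change of basis preserves scalar products as well as an orthogonal one. *)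
Lemma symmetric_spectral (R : rcfType) (n : nat) (N : 'M[R]_n) : N^T = N ->
  exists (d : 'rV[R]_n) (U : 'M[R[i]%C]_n),
    U \is unitarymx /\ N%:CM = invmx U *m diag_mx d%:CM *m U.
Proof.
move=> Nsym; have Nherm : N%:CM \is hermsymmx.
  by apply/is_hermitianmxP; rewrite expr0 scale1r conj_mx_real_complex Nsym.
have /mxOverP d_real := hermitian_spectral_diag_real Nherm.
have /orthomx_spectralP N_eq := hermitian_normalmx Nherm.
exists (\row_i complex.Re (spectral_diag N%:CM 0 i)), (spectralmx N%:CM).
split; first exact: spectral_unitarymx.
rewrite [LHS]N_eq; congr (_ *m diag_mx _ *m _).
by apply/rowP => i; rewrite !mxE RRe_real.
Qed.

Lemma char_poly_1B_spectral (R : rcfType) (n : nat) (N : 'M[R]_n)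
    (d : 'rV[R]_n) (U : 'M[R[i]%C]_n) :
    U \in unitmx -> N%:CM = invmx U *m diag_mx d%:CM *m U ->
  char_poly (1%:M - N) = \prod_(i < n) ('X - (1 - d 0 i)%:P).
Proof.
move=> U_unit N_eq; apply: (@map_poly_inj _ _ (real_complex R)).
have E : (1%:M - N)%:CM = invmx U *m diag_mx (\row_i (1 - d 0 i))%:CM *m U.
  have -> : diag_mx (\row_i (1 - d 0 i))%:CM = 1%:M - diag_mx d%:CM.
    by apply/matrixP => i j; rewrite !mxE rmorphB rmorph1 mulrnBl.
  by rewrite mulmxBr mulmxBl mulmx1 mulVmx // -N_eq map_mxB map_mx1.
rewrite map_char_poly E char_poly_conj // char_poly_diag rmorph_prod.
by apply: eq_bigr => i _; rewrite /= map_polyXsubC !mxE.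
Qed.

Lemma row_mul_trmxE (R : pzSemiRingType) (n : nat) (u v : 'rV[R]_n) :
  (u *m v^T) 0 0 = \sum_i u 0 i * v 0 i.
Proof. by rewrite !mxE; apply: eq_bigr => i _; rewrite !mxE. Qed.

(** In the eigenbasis, the fixed vector [u] is carried by the coordinate [k]
    alone; so [(u . v)^2 / (u . u)] is the square of the coordinate [k] of
    [v], which [N] preserves, whereas [N] scales the others by at most [t].
    Multiplying by [u . u] avoids the division. *)
Lemma norm_sq_le_simple_fixed (R : rcfType) (n : nat) (N : 'M[R]_n)
    (d : 'rV[R]_n) (U : 'M[R[i]%C]_n) (k : 'I_n) (t : R) (u v : 'rV[R]_n) :
    U \is unitarymx -> N%:CM = invmx U *m diag_mx d%:CM *m U ->
    u *m N = u -> d 0 k = 1 -> t < 1 ->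
    (forall i, i != k -> `|d 0 i| <= t) ->
  (u *m u^T) 0 0 * ((v *m N) *m (v *m N)^T) 0 0 <=
  t ^+ 2 * ((u *m u^T) 0 0 * (v *m v^T) 0 0) +
    (1 - t ^+ 2) * ((u *m v^T) 0 0) ^+ 2.
Proof.
move=> U_unitary N_eq uN dk t1 dt.
(* The coordinates of w in the basis formed by the rows of U. *)
pose c (w : 'rV[R]_n) := w%:CM *m U^*t.
have dotE (w z : 'rV[R]_n) :
    (((w *m z^T) 0 0)%:C)%C = \sum_i c w 0 i * (c z 0 i)^*.
  have -> : (((w *m z^T) 0 0)%:C)%C = (c w *m (c z)^*t) 0 0.
    rewrite /c trmx_mul map_mxM trmxCK mulmxA mulmxKtV //.
    by rewrite conj_mx_real_complex -map_mxM [RHS]mxE.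
  by rewrite [LHS]mxE; apply: eq_bigr => i _; congr (_ * _); rewrite 2!mxE.
have cN (w : 'rV[R]_n) i : c (w *m N) 0 i = (d 0 i)%:C%C * c w 0 i.
  rewrite /c map_mxM N_eq invmx_unitary // !mulmxA mulmxtVK //.
  by rewrite mul_mx_diag !mxE mulrC.
pose sqn (w : 'rV[R]_n) i :=
  complex.Re (c w 0 i) ^+ 2 + complex.Im (c w 0 i) ^+ 2.
have sqnE (w : 'rV[R]_n) i : (sqn w i)%:C%C = c w 0 i * (c w 0 i)^*.
  by rewrite add_Re2_Im2 normCK.
have sqn_ge0 (w : 'rV[R]_n) i : 0 <= sqn w i by rewrite addr_ge0 ?sqr_ge0.
have dotwwE (w : 'rV[R]_n) : (w *m w^T) 0 0 = \sum_i sqn w i.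
  apply: complexI; rewrite dotE rmorph_sum.
  by apply: eq_bigr => i _; rewrite /= sqnE.
have sqnN i : sqn (v *m N) i = d 0 i ^+ 2 * sqn v i.
  apply: complexI; rewrite rmorphM /= !sqnE cN rmorphM /= conj_real_complex.
  by rewrite rmorphXn /= mulrACA.
have cu0 i : i != k -> c u 0 i = 0.
  move=> /dt di; have /eqP := cN u i; rewrite uN -subr_eq0 -{1}[c u 0 i]mul1r.
  rewrite -mulrBl mulf_eq0 => /orP[|/eqP//]; rewrite subr_eq0 => /eqP.
  move=> /(@complexI _ 1) d1; move: di.
  by rewrite -d1 normr1 leNgt t1.
have uuE : (u *m u^T) 0 0 = sqn u k.
  rewrite dotwwE (bigD1 k) //= big1 ?addr0 // => i /cu0 ci0.
  by apply: complexI; rewrite sqnE ci0 mul0r.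
have uvE : ((u *m v^T) 0 0) ^+ 2 = sqn u k * sqn v k.
  have E : ((u *m v^T) 0 0)%:C%C = c u 0 k * (c v 0 k)^*.
    by rewrite dotE (bigD1 k) //= big1 ?addr0 // => i /cu0 ->; rewrite mul0r.
  apply: complexI; rewrite rmorphXn rmorphM /= !sqnE expr2.
  (* u . v is real, so its square is the square of its modulus. *)
  rewrite -{2}conj_real_complex E rmorphM /= conjCK mulrACA.
  by congr (_ * _); rewrite mulrC.
have -> : ((v *m N) *m (v *m N)^T) 0 0 =
    sqn v k + \sum_(i | i != k) d 0 i ^+ 2 * sqn v i.
  rewrite dotwwE; under eq_bigr => i _ do rewrite sqnN.
  by rewrite (bigD1 k) //= dk expr1n mul1r.
have le_tail : \sum_(i | i != k) d 0 i ^+ 2 * sqn v i <=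
    t ^+ 2 * \sum_(i | i != k) sqn v i.
  rewrite mulr_sumr ler_sum // => i /dt di; rewrite ler_wpM2r //.
  by rewrite -real_normK ?num_real // lerXn2r ?nnegrE // (le_trans _ di).
rewrite uvE uuE dotwwE [\sum_i sqn v i](bigD1 k) //=.
have := ler_wpM2l (sqn_ge0 u k) le_tail; lra.
Qed.

(** * The symmetric normalization of the adjacency matrix *)

Section Graph.
Context {R : realType} {T : finType} {e : rel T}.
Context (e_simple : simple_graph e) (e_noiso : no_isolated_vertex e).

Local Notation degR v := ((deg e v)%:R : R).

Lemma e_sym : symmetric e. Proof. by case: e_simple. Qed.

Lemma degR_gt0 v : 0 < degR v. Proof. by rewrite ltr0n. Qed.

Definition root_deg (i : 'I_#|T|) : R := Num.sqrt (degR (enum_val i)).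

Lemma root_deg_gt0 i : 0 < root_deg i.
Proof. by rewrite sqrtr_gt0 degR_gt0. Qed.

Lemma root_deg_sqr i : root_deg i ^+ 2 = degR (enum_val i).
Proof. by rewrite sqr_sqrtr // ltW // degR_gt0. Qed.

Definition sym_adjacency : 'M[R]_#|T| :=
  \matrix_(i, j) ((e (enum_val i) (enum_val j))%:R / (root_deg i * root_deg j)).

Lemma sym_adjacency_tr : sym_adjacency^T = sym_adjacency.
Proof. by apply/matrixP => i j; rewrite !mxE e_sym [_ * root_deg _]mulrC. Qed.

Lemma normalized_laplacianE (i j : 'I_#|T|) :
  normalized_laplacian R e i j =
  (i == j)%:R - (e (enum_val i) (enum_val j))%:R / degR (enum_val i).
Proof.
rewrite /normalized_laplacian /degree_mx invmx_diag; last first.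
  by move=> k; rewrite mxE gt_eqF // degR_gt0.
by rewrite mul_diag_mx !mxE mulrC.
Qed.

Lemma laplacian_similar : exists2 B, B \in unitmx &
  normalized_laplacian R e = invmx B *m (1%:M - sym_adjacency) *m B.
Proof.
pose B := diag_mx (\row_i root_deg i).
have b0 i : root_deg i != 0 by rewrite gt_eqF // root_deg_gt0.
have B_unit : B \in unitmx.
  by rewrite unitmxE det_diag unitfE; apply/prodf_neq0 => i _; rewrite mxE b0.
exists B => //; rewrite invmx_diag; last by move=> i; rewrite mxE.
apply/matrixP => i j.
rewrite normalized_laplacianE mul_mx_diag mul_diag_mx !mxE.
rewrite mulrBr mulrBl -root_deg_sqr; congr (_ - _); last first.
  by field; rewrite !b0.
have [->|_] := eqVneq i j; last by rewrite mulr0 mul0r.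
by rewrite mulr1 mulVf.
Qed.

Lemma sum_enum_val (F : T -> R) : \sum_(i < #|T|) F (enum_val i) = \sum_v F v.
Proof.
by rewrite [RHS](reindex (@enum_val T T)) //; exact/onW_bij/enum_val_bij.
Qed.

Lemma volR (S : {set T}) : (vol e S)%:R = \sum_v (v \in S)%:R * degR v.
Proof.
rewrite /vol natr_sum big_mkcond /=; apply: eq_bigr => v _.
by case: (v \in S); rewrite ?mul1r ?mul0r.
Qed.

Lemma edges_toR w (S : {set T}) :
  (edges_to e w S)%:R = \sum_v (v \in S)%:R * (e w v)%:R :> R.
Proof.
rewrite /edges_to -sum1_card natr_sum big_mkcond /=; apply: eq_bigr => v _.
by rewrite inE; case: (v \in S); case: (e w v); rewrite ?mul1r ?mul0r.
Qed.

Lemma degE w : deg e w = edges_to e w [set: T].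
Proof. by congr #|pred_of_set _|; apply/setP => v; rewrite !inE. Qed.

Lemma degR_sum w : degR w = \sum_v (e w v)%:R.
Proof.
rewrite degE edges_toR.
by under eq_bigr => v _ do rewrite in_setT mul1r.
Qed.

(** The weighted indicator vector [D^(1/2) 1_S]. *)
Definition root_deg_row (S : {set T}) : 'rV[R]_#|T| :=
  \row_i ((enum_val i \in S)%:R * root_deg i).

Lemma dot_root_deg_row (S S' : {set T}) : S \subset S' ->
  (root_deg_row S' *m (root_deg_row S)^T) 0 0 = (vol e S)%:R.
Proof.
move=> SS'; rewrite row_mul_trmxE volR -sum_enum_val; apply: eq_bigr => i _.
rewrite !mxE -root_deg_sqr; case: (boolP (_ \in S)) => [vS|_].
  by rewrite (subsetP SS' _ vS) !mul1r.
by rewrite !mul0r mulr0.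
Qed.

Lemma root_deg_row_sym_adjacency (S : {set T}) i :
  (root_deg_row S *m sym_adjacency) 0 i =
  (edges_to e (enum_val i) S)%:R / root_deg i.
Proof.
rewrite mxE edges_toR -sum_enum_val mulr_suml; apply: eq_bigr => j _.
rewrite !mxE e_sym; have := root_deg_gt0 i; have := root_deg_gt0 j.
by move=> /gt_eqF/negbT bj /gt_eqF/negbT bi; field; rewrite bi bj.
Qed.

Lemma root_deg_row_fixed :
  root_deg_row [set: T] *m sym_adjacency = root_deg_row [set: T].
Proof.
apply/rowP => i; rewrite root_deg_row_sym_adjacency -degE -root_deg_sqr mxE.
by rewrite inE mul1r expr2 mulfK // gt_eqF // root_deg_gt0.
Qed.

Lemma norm_root_deg_row_sym_adjacency (S : {set T}) :
  let z := root_deg_row S *m sym_adjacency in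
  (z *m z^T) 0 0 = \sum_w (edges_to e w S)%:R ^+ 2 / degR w.
Proof.
rewrite /= row_mul_trmxE -sum_enum_val; apply: eq_bigr => i _.
by rewrite root_deg_row_sym_adjacency -root_deg_sqr -expr2 expr_div_n.
Qed.

(** * Bounds on [tau] and on [htilde_set] *)

Lemma sum_edges_to (S : {set T}) :
  \sum_w (edges_to e w S)%:R = (vol e S)%:R :> R.
Proof.
under eq_bigr => w _ do rewrite edges_toR.
rewrite exchange_big volR; apply: eq_bigr => v _; rewrite -mulr_sumr degR_sum.
by under eq_bigr => w _ do rewrite e_sym.
Qed.

Lemma edges_to_le_deg w (S : {set T}) : (edges_to e w S <= deg e w)%N.
Proof.
by apply: subset_leq_card; apply/subsetP => v; rewrite !inE => /andP[].
Qed.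

Lemma htilde_set_le1 (S : {set T}) : htilde_set R e S <= 1.
Proof.
rewrite /htilde_set; have [->|vol0] := eqVneq (vol e S) 0%N.
  by rewrite invr0 mul0r.
rewrite mulrC ler_pdivrMr ?mul1r ?ltr0n ?lt0n //.
rewrite -sum_edges_to; apply: ler_sum => w _.
rewrite ler_pdivrMr ?degR_gt0 // expr2 ler_wpM2l //.
by rewrite ler_nat edges_to_le_deg.
Qed.

Lemma tau_ge i : (1 <= i < #|T|)%N ->
  `|1 - (real_spectrum (normalized_laplacian R e))`_i| <= tau R e.
Proof.
move=> i_lt; rewrite /tau.
apply: (le_bigmax_seq 0 i predT
  (fun j => `|1 - (real_spectrum (normalized_laplacian R e))`_j|)) => //.
by rewrite mem_index_iota.
Qed.

Lemma tau_ge0 : 0 <= tau R e.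
Proof. exact: bigmax_ge_id. Qed.

(** The rows of [D^-1 A] are probability vectors, so right multiplication by
    this matrix does not increase the l1 norm of a row vector, and its
    eigenvalues lie in the unit disc. *)
Lemma tau_le1 : tau R e <= 1.
Proof.
apply: bigmax_le => // i _.
(* Past the end of the list the default entry 0 also satisfies the bound. *)
set s := real_spectrum _; have [i_lt|i_ge] := ltnP i (size s); last first.
  by rewrite nth_default // subr0 normr1.
have /eigenvalueP[v vL v0] := real_spectrum_eigenvalue (mem_nth 0 i_lt).
set x := s`_i in vL *.
have vP j : (1 - x) * v 0 j =
    \sum_k v 0 k * ((e (enum_val k) (enum_val j))%:R / degR (enum_val k)).
  have /rowP/(_ j) := vL; rewrite !mxE mulrBl mul1r => <-.
  under [in LHS]eq_bigr => k _ do rewrite normalized_laplacianE mulrBr.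
  rewrite sumrB (bigD1 j) //= eqxx mulr1 big1 ?addr0 ?subKr //.
  by move=> k /negPf ->; rewrite mulr0.
have row_sum (k : 'I_#|T|) :
    \sum_(j < #|T|) (e (enum_val k) (enum_val j))%:R / degR (enum_val k) = 1 :> R.
  have := sum_enum_val (fun w => (e (enum_val k) w)%:R); rewrite -degR_sum.
  by rewrite /= -mulr_suml => ->; rewrite divff // gt_eqF // degR_gt0.
have v_gt0 : 0 < \sum_j `|v 0 j|.
  rewrite lt_def sumr_ge0 // andbT; apply: contraNneq v0 => /eqP.
  rewrite psumr_eq0 // => /allP vj0; apply/eqP/rowP => j; rewrite mxE.
  by apply/eqP; rewrite -normr_eq0; apply: vj0; rewrite mem_index_enum.
rewrite -(ler_pM2r v_gt0) mul1r mulr_sumr.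
apply: (@le_trans _ _ (\sum_j \sum_k `|v 0 k| *
    ((e (enum_val k) (enum_val j))%:R / degR (enum_val k)))).
  apply: ler_sum => j _; rewrite -normrM vP.
  apply: le_trans (ler_norm_sum _ _ _) _; apply: ler_sum => k _.
  by rewrite normrM [X in _ * X <= _]ger0_norm // divr_ge0.
rewrite exchange_big; apply: ler_sum => k _.
by rewrite -mulr_sumr row_sum mulr1.
Qed.

(** If [tau < 1], the conclusion is the inequality of
    [norm_sq_le_simple_fixed] for [u := D^(1/2) 1] and [v := D^(1/2) 1_S];
    otherwise [htilde_set_le1] is enough. *)
Lemma htilde_set_le_tau (S : {set T}) : S != set0 ->
    (vol e S)%:R <= (vol e [set: T])%:R / 2 :> R ->
  2 * htilde_set R e S - 1 <= tau R e ^+ 2.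
Proof.
move=> S0 S_half; have [t1|t1] := ltP (tau R e) 1; last first.
  have := htilde_set_le1 S; have := exprn_ege1 2 t1; lra.
have [v vS] := set0Pn _ S0.
have volS : 0 < (vol e S)%:R :> R.
  by rewrite ltr0n /vol (bigD1 v) //= addn_gt0 e_noiso.
have [d [U [U_unitary N_eq]]] := symmetric_spectral sym_adjacency_tr.
have U_unit := unitarymx_unit U_unitary.
have [B B_unit L_eq] := laplacian_similar.
have chE : char_poly (1%:M - sym_adjacency) =
    \prod_(x <- [seq 1 - d 0 i | i <- enum 'I_#|T|]) ('X - x%:P).
  by rewrite (char_poly_1B_spectral U_unit N_eq) big_map big_enum.
have spec : perm_eq (real_spectrum (normalized_laplacian R e))
    [seq 1 - d 0 i | i <- enum 'I_#|T|].
  by apply: perm_real_spectrum; rewrite L_eq char_poly_conj.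
have uN := root_deg_row_fixed; set u := root_deg_row setT in uN.
have u0 : u != 0.
  apply/eqP => /rowP/(_ (enum_rank v)); rewrite !mxE in_setT mul1r.
  by apply/eqP; rewrite gt_eqF // root_deg_gt0.
have [k dk] : exists k, 1 - d 0 k = 0.
  have : eigenvalue (1%:M - sym_adjacency) 0.
    by apply/eigenvalueP; exists u; rewrite // mulmxBr mulmx1 uN subrr scale0r.
  rewrite eigenvalue_root_char chE root_prod_XsubC => /mapP[k _ dk].
  by exists k.
have d_le i : i != k -> `|d 0 i| <= tau R e.
  move=> ik; rewrite -[d 0 i](subKr 1).
  exact: (le_of_tail_le spec tau_ge t1 dk).
move/eqP: dk; rewrite subr_eq0 eq_sym => /eqP dk.
have := norm_sq_le_simple_fixed (root_deg_row S) U_unitary N_eq uN dk t1 d_le.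
rewrite norm_root_deg_row_sym_adjacency !dot_root_deg_row ?subsetT //.
rewrite /htilde_set.
set h := \sum_w _; set x := (vol e S)%:R in volS S_half *.
set y := (vol e setT)%:R in S_half * => main.
have tau0 := tau_ge0.
have : x * (y * (2 * (x^-1 * h) - 1)) <= x * (y * tau R e ^+ 2).
  have -> : x * (y * (2 * (x^-1 * h) - 1)) = 2 * (y * h) - x * y.
    by field; rewrite gt_eqF.
  (* This product is where the assumption vol S <= vol V / 2 enters. *)
  have : 0 <= x * ((1 - tau R e ^+ 2) * (y - 2 * x)).
    have t2 : tau R e ^+ 2 <= 1 by rewrite expr_le1 // ltW.
    by rewrite mulr_ge0 ?(ltW volS) // mulr_ge0 ?subr_ge0 //; lra.
  nra.
by rewrite !ler_pM2l //; lra.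
Qed.

End Graph.

(** * The inequality and its sharpness *)

Unset Implicit Arguments.

Theorem corollary5p5 (R : realType) :
  (forall (T : finType) (e : rel T),
     (0 < #|T|)%N -> simple_graph e -> no_isolated_vertex e ->
     tau R e ^+ 2 >= 2 * htilde R e - 1) /\
  (exists (T : finType) (e : rel T),
     [/\ (0 < #|T|)%N, simple_graph e, no_isolated_vertex e &
         tau R e ^+ 2 = 2 * htilde R e - 1]).
Proof.
have main (T : finType) (e : rel T) :
    simple_graph e -> no_isolated_vertex e ->
    2 * htilde R e - 1 <= tau R e ^+ 2.
  move=> e_simple e_noiso.
  suff : htilde R e <= (tau R e ^+ 2 + 1) / 2 by lra.
  apply: bigmax_le => [|S /andP[S0 S_half]].
    by rewrite divr_ge0 // addr_ge0 // sqr_ge0.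
  have := htilde_set_le_tau e_simple e_noiso S0 S_half; lra.
split=> [T e _|]; first exact: main.
(* Equality case: a single edge, with the two booleans as vertices. *)
pose e (x y : bool) := x != y.
have e_simple : simple_graph e by split=> [x y|x]; rewrite /e ?eqxx // eq_sym.
have deg1 x : deg e x = 1%N.
  rewrite /deg (_ : [set y | e x y] = [set ~~ x]) ?cards1 //.
  by apply/setP => -[]; rewrite !inE; case: x.
have e_noiso : no_isolated_vertex e by move=> x; rewrite deg1.
exists bool, e; split=> //; first by rewrite card_bool.
apply/eqP; rewrite eq_le [X in _ && X]main // andbT.
suff : 1 <= htilde R e.
  have : tau R e ^+ 2 <= 1 by rewrite expr_le1 ?tau_ge0 ?tau_le1.
  lra.
apply: (bigmax_sup [set true]).
  rewrite -card_gt0 cards1 /= /vol big_set1 [in X in _ <= X]big_mkcond big_bool.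
  by rewrite !in_setT !deg1 divff ?pnatr_eq0.
have edges_true : edges_to e true [set true] = 0%N.
  by apply/eqP; rewrite cards_eq0; apply/eqP/setP => -[]; rewrite !inE.
have edges_false : edges_to e false [set true] = 1%N.
  by apply/eqP/cards1P; exists true; apply/setP => -[]; rewrite !inE.
rewrite /= /htilde_set /vol big_set1 big_bool !deg1 edges_true edges_false /=.
by rewrite invr1 mul1r !mulr1 expr0n expr1n add0r.
Qed.
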